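(* Let $n\in\{2,3,\dots\}$. (i) There exist only finitely many, namely $\frac{n(n-1)\,n!}{4}$, equivalence classes of connected sequences of two-element subsets of $\{1,\dots,n\}$. (ii) For all two-element subsets $\{i,j\},\{k,l\}$ of $\{1,\dots,n\}$, the number of equivalence classes of connected sequences whose first element is $\{i,j\}$ and whose last element is $\{k,l\}$ equals $(n-2)!$.
   Context: Let $\binom{\mathbf{n}}{2}$ be the set of two-element subsets of $\mathbf{n}=\{1,\dots,n\}$. Two elements $\{i,j\}$ and $\{k,l\}$ of $\binom{\mathbf{n}}{2}$ are connected if $\{i,j\}\cap\{k,l\}\neq\varnothing$. A connected sequence is a non-empty finite sequence $\{i_1,j_1\},\dots,\{i_m,j_m\}$ of elements of $\binom{\mathbf{n}}{2}$ such that $\{i_l,j_l\}$ and $\{i_{l+1},j_{l+1}\}$ are connected for all $l=1,\dots,m-1$. Two connected sequences are equivalent if one can be obtained from the other by a finite number of the following operations on fragments of consecutive terms (all pairs appearing being two-element subsets): (I) replacing $\{i,j\},\{i,j\}$ by $\{i,j\}$ and vice versa; (II) replacing $\{i,j\},\{j,k\},\{k,l\}$ by $\{i,j\},\{i,l\},\{k,l\}$ and vice versa, where $i\neq l$; (III) replacing $\{i,j\},\{j,k\},\{k,i\}$ by $\{i,j\},\{k,i\}$ and vice versa; (IV) replacing $\{i,j\},\{j,k\},\{i,j\}$ by $\{i,j\}$ and vice versa. These operations preserve connectedness and do not change the first and the last element of the sequence. *)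

(* Defs.v *)
From Stdlib Require Import Relations.
From mathcomp Require Import classical_sets cardinality.
From mathcomp Require Import all_boot.

Set Implicit Arguments.
Unset Strict Implicit.
Unset Printing Implicit Defensive.

Section ConnectedSequences.
Variable n : nat.

(* The ground set {1, ..., n} is represented by 'I_n = {0, ..., n - 1}. *)
Implicit Types (e f : {set 'I_n}) (s t : seq {set 'I_n}).

Definition two_subset e : bool := #|e| == 2.

Definition connected e f : bool := e :&: f != set0.

Definition connected_seq s : bool :=
  [&& s != [::], all two_subset s & sorted connected s].

(* Each rule is given in one direction only; its inverse comes from the
   symmetric closure in [seq_equiv]. The inequalities say exactly that every
   pair written on either side has two elements; further coincidences, such as
   i = k or j = l in [rule_II], are allowed. *)
Inductive rule : seq {set 'I_n} -> seq {set 'I_n} -> Prop :=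
| rule_I (i j : 'I_n) of i != j :
    rule [:: [set i; j]; [set i; j]] [:: [set i; j]]
| rule_II (i j k l : 'I_n) of i != j & j != k & k != l & i != l :
    rule [:: [set i; j]; [set j; k]; [set k; l]]
         [:: [set i; j]; [set i; l]; [set k; l]]
| rule_III (i j k : 'I_n) of i != j & j != k & k != i :
    rule [:: [set i; j]; [set j; k]; [set k; i]]
         [:: [set i; j]; [set k; i]]
| rule_IV (i j k : 'I_n) of i != j & j != k :
    rule [:: [set i; j]; [set j; k]; [set i; j]] [:: [set i; j]].

Inductive step : seq {set 'I_n} -> seq {set 'I_n} -> Prop :=
| Step p a b q of rule a b : step (p ++ a ++ q) (p ++ b ++ q).

Definition seq_equiv : relation (seq {set 'I_n}) :=
  clos_refl_sym_trans _ step.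

Definition seq_class s : set (seq {set 'I_n}) :=
  [set t | connected_seq t /\ seq_equiv s t]%classic.

Definition classes : set (set (seq {set 'I_n})) :=
  [set seq_class s | s in [set s | connected_seq s]]%classic.

(* The default value set0 of head and last is never used, since connected
   sequences are non-empty. *)
Definition classes_between e f : set (set (seq {set 'I_n})) :=
  [set seq_class s | s in
    [set s | [/\ connected_seq s, head set0 s = e & last set0 s = f]]]%classic.

Lemma rule_pres a b : rule a b ->
  [/\ a != [::] /\ b != [::],
      all two_subset a && sorted connected a,
      all two_subset b && sorted connected b
    & forall x, head x a = head x b /\ last x a = last x b].
Proof.
have con x e f : x \in e -> x \in f -> connected e f.
  by move=> xe xf; apply/set0Pn; exists x; rewrite inE xe.
case=> [i j ij|i j k l ij jk kl il|i j k ij jk ki|i j k ij jk];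
  split=> //=; rewrite /two_subset !cards2 ?ij ?jk ?kl ?il ?ki /=.
all: rewrite ?andbT; repeat (apply/andP; split).
all: try match goal with x : 'I_n |- _ =>
  by (apply: (con x); rewrite !inE eqxx ?orbT) end.
all: by [].
Qed.

Lemma connected_seq_step s t : step s t ->
  [/\ connected_seq s = connected_seq t,
      head set0 s = head set0 t & last set0 s = last set0 t].
Proof.
case=> p a b q /rule_pres [[a0 b0] /andP[ta sa] /andP[tb sb] hl].
case: a b a0 b0 ta sa tb sb hl => [//|x a] [//|y b] _ _ ta sa tb sb hl.
have {hl}[/= xy lab] := hl x; rewrite -{}xy in tb sb lab *.
move: ta tb sa sb => /= /andP[tx ta] /andP[_ tb] sa sb.
split.
- rewrite /connected_seq !all_cat /= !all_cat tx ta tb.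
  by case: p => [|z p] /=; rewrite ?cat_path /= ?cat_path sa sb lab.
- by case: p.
- by rewrite !last_cat /= !last_cat lab.
Qed.

End ConnectedSequences.

Arguments classes n : clear implicits.

Lemma class_count_dvd4 n : 2 <= n -> 4 %| n * (n - 1) * n`!.
Proof.
move=> n2; rewrite -[4]/(2 * 2); apply: dvdn_mul; last by rewrite dvdn_fact.
by rewrite dvdn2 oddM; case: n n2 => // m _; rewrite subn1 /= andNb.
Qed.

(* Main.v *)
(* Place a token on each of the n - 2 elements outside a pair e. Moving from
   {i, j} to {j, k} slides the token at k to the vacated i, so a connected
   sequence from e to f induces a bijection between the complements of e and f,
   and rules (I)-(IV) preserve it. Every bijection arises because transpositions
   do. Conversely the bijection determines the class, by induction on the set A
   of positions allowed in the sequences: for p in A outside e, a sequence whose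
   last term avoids p is equivalent either to one avoiding p altogether, or to
   {a,b}, {a,p}, {a,x} followed by one avoiding p, and then x is the initial
   position of the token that ends at p. Hence there are (n - 2)! classes
   between any two given pairs. *)
From Stdlib Require Import Relations.
From mathcomp Require Import fingroup perm action.
Require Import Defs.
From mathcomp Require Import classical_sets cardinality.
From mathcomp Require Import all_boot.

Set Implicit Arguments.
Unset Strict Implicit.
Unset Printing Implicit Defensive.

Section Equivalence.
Variable n : nat.
Implicit Types (a b i j k l p x y : 'I_n) (A e f : {set 'I_n}).
Implicit Types (q s t : seq {set 'I_n}).

Local Notation "s ~ t" := (@seq_equiv n s t) (at level 70).

(** * Equivalence as a congruence, and the rules at the head of a sequence *)

Lemma seq_equiv_refl s : s ~ s. Proof. exact: rst_refl. Qed.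

Lemma seq_equiv_sym s t : s ~ t -> t ~ s. Proof. exact: rst_sym. Qed.

Lemma seq_equiv_trans s t u : s ~ t -> t ~ u -> s ~ u.
Proof. exact: rst_trans. Qed.

Lemma seq_equiv_cat (r q s t : seq {set 'I_n}) : s ~ t -> r ++ s ++ q ~ r ++ t ++ q.
Proof.
elim=> [u v [p' a b q' ab]|u|u v _ IH|u v w _ IH1 _ IH2].
- by apply: rst_step; rewrite -!catA !(catA r p'); apply: Step.
- exact: rst_refl.
- exact: rst_sym.
- exact: rst_trans IH1 IH2.
Qed.

Lemma seq_equiv_cons e s t : s ~ t -> e :: s ~ e :: t.
Proof. by move=> /(seq_equiv_cat [:: e] [::]); rewrite !cats0. Qed.

Lemma seq_equiv_rcons e s t : s ~ t -> rcons s e ~ rcons t e.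
Proof. by move=> /(seq_equiv_cat [::] [:: e]) /=; rewrite !cats1. Qed.

Lemma rule_equiv (a b q : seq {set 'I_n}) : rule a b -> a ++ q ~ b ++ q.
Proof. by move=> ab; apply: rst_step; apply: (@Step _ [::]). Qed.

Lemma set2C i j : [set i; j] = [set j; i].
Proof. exact: setUC. Qed.

Lemma equivI e q : two_subset e -> [:: e, e & q] ~ e :: q.
Proof. by move=> /cards2P[i [j [ij ->]]]; apply: rule_equiv (rule_I ij). Qed.

Lemma equivII i j k l q : i != j -> j != k -> k != l -> i != l ->
  [:: [set i; j], [set j; k], [set k; l] & q] ~
  [:: [set i; j], [set i; l], [set k; l] & q].
Proof. by move=> ij jk kl il; apply: rule_equiv (rule_II ij jk kl il). Qed.

Lemma equivIII i j k q : i != j -> j != k -> k != i ->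
  [:: [set i; j], [set j; k], [set k; i] & q] ~
  [:: [set i; j], [set k; i] & q].
Proof. by move=> ij jk ki; apply: rule_equiv (rule_III ij jk ki). Qed.

Lemma equivIV i j k q : i != j -> j != k ->
  [:: [set i; j], [set j; k], [set i; j] & q] ~ [set i; j] :: q.
Proof. by move=> ij jk; apply: rule_equiv (rule_IV ij jk). Qed.

Lemma two_subsetP i e : two_subset e -> i \in e ->
  exists2 j, i != j & e = [set i; j].
Proof.
move=> /cards2P[x [y [xy ->]]]; rewrite !inE => /orP[]/eqP->; first by exists y.
by exists x; [rewrite eq_sym | rewrite set2C].
Qed.

Lemma two_subset2 i j : two_subset [set i; j] = (i != j).
Proof. by rewrite /two_subset cards2; case: (i != j). Qed.

Lemma connectedP e f : two_subset e -> two_subset f -> connected e f ->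
  e = f \/ exists i j k,
    [/\ i != j, j != k, i != k, e = [set i; j] & f = [set j; k]].
Proof.
move=> e2 f2 /set0Pn[j /setIP[je jf]].
have [i ji ->] := two_subsetP e2 je; have [k jk ->] := two_subsetP f2 jf.
have [->|ik] := eqVneq i k; first by left.
by right; exists i, j, k; rewrite eq_sym ji set2C.
Qed.

Lemma connected2 i j k : connected [set i; j] [set j; k].
Proof. by apply/set0Pn; exists j; rewrite !inE eqxx orbT. Qed.

(** * The bijection induced by a connected sequence *)

(* [slide] and [track] are permutations of all of 'I_n, but their values on the
   initial pair carry no information: the rules do not preserve them. *)
Definition slide e f : {perm 'I_n} :=
  if ([pick i in e :\: f], [pick k in f :\: e]) is (Some i, Some k)
  then tperm i k else 1%g.

Fixpoint track e s : {perm 'I_n} :=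
  if s is f :: s' then (slide e f * track f s')%g else 1%g.

Lemma slide_id e : slide e e = 1%g.
Proof. by rewrite /slide; case: pickP => // x; rewrite setDv inE. Qed.

Lemma slideE i j k : i != j -> j != k -> i != k ->
  slide [set i; j] [set j; k] = tperm i k.
Proof.
move=> ij jk ik; rewrite /slide.
case: pickP => [x|/(_ i)]; last first.
  by rewrite !inE eqxx (negPf ij) (negPf ik).
rewrite !inE negb_or => /andP[/andP[xj _]]; rewrite (negPf xj) orbF => /eqP->.
case: pickP => [y|/(_ k)]; last first.
  by rewrite !inE eqxx [k == i]eq_sym [k == j]eq_sym (negPf jk) (negPf ik) orbT.
by rewrite !inE negb_or => /andP[/andP[_ yj]]; rewrite (negPf yj) => /eqP->.
Qed.

Lemma slideE_l i j k : i != j -> j != k -> i != k ->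
  slide [set j; i] [set j; k] = tperm i k.
Proof. by rewrite [[set j; i]]set2C; apply: slideE. Qed.

Lemma slideE_r i j k : i != j -> j != k -> i != k ->
  slide [set i; j] [set k; j] = tperm i k.
Proof. by rewrite [[set k; j]]set2C; apply: slideE. Qed.

Lemma slideE_lr i j k : i != j -> j != k -> i != k ->
  slide [set j; i] [set k; j] = tperm i k.
Proof. by rewrite [[set k; j]]set2C; apply: slideE_l. Qed.

Lemma track_cat e s t : track e (s ++ t) = (track e s * track (last e s) t)%g.
Proof. by elim: s e => [|f s IH] e /=; rewrite ?mul1g // IH mulgA. Qed.

Lemma mem_slide e f x : two_subset e -> two_subset f -> connected e f ->
  (slide e f x \in f) = (x \in e).
Proof.
move=> e2 f2 /(connectedP e2 f2)[<-|[i [j [k [ij jk ik -> ->]]]]].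
  by rewrite slide_id perm1.
rewrite slideE // !inE; case: tpermP => [->|->|/eqP/negPf-> /eqP/negPf->].
- by rewrite !eqxx orbT.
- by rewrite [k == i]eq_sym [k == j]eq_sym (negPf jk) (negPf ik) (negPf ij).
- by rewrite orbF.
Qed.

Lemma mem_track e s x : two_subset e -> all (@two_subset n) s ->
  path (@connected n) e s -> (track e s x \in last e s) = (x \in e).
Proof.
elim: s e x => [|f s IH] e x e2 /=; first by rewrite perm1.
by move=> /andP[f2 s2] /andP[ef fs]; rewrite permM IH // mem_slide.
Qed.

(** Compares products of transpositions at a point by splitting on the equalities between
    variables. *)
Ltac eq_cases :=
  rewrite ?permM ?permE /=;
  repeat (match goal with
  | |- context [?x == ?y] => is_var x; is_var y; case: (eqVneq x y) => /= ?; subst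
  end);
  try done;
  match goal with H : is_true (?x != ?x) |- _ => by case/eqP: H end.

(** In the generic case of (II) the two sides compose the disjoint transpositions [tperm i k] and
    [tperm j l] in opposite orders. In (IV) the slides cancel. In (III) both sides send the token at
    [k] to [j] and differ only on [{i, j}]. *)
Lemma rule_track (a b : seq {set 'I_n}) : rule a b ->
  forall x, x \notin head set0 a ->
  track (head set0 a) (behead a) x = track (head set0 b) (behead b) x.
Proof.
case=> [i j ij|i j k l ij jk kl il|i j k ij jk ki|i j k ij jk] x /=.
- by rewrite slide_id mulg1.
- have [<-|ik] := eqVneq i k.
    by rewrite (set2C j i) !slide_id !mulg1 mul1g.
  have [<-|jl] := eqVneq j l.
    by rewrite (set2C k j) !slide_id !mulg1 mul1g.
  move=> _; have [ji li lk] : [/\ j != i, l != i & l != k].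
    by split; rewrite eq_sym.
  by rewrite !slideE // slideE_l // slideE_r // !mulg1; eq_cases.
- have [ji kj ik] : [/\ j != i, k != j & i != k].
    by split; rewrite eq_sym.
  rewrite !inE negb_or => /andP[xi xj].
  by rewrite !slideE // slideE_lr // !mulg1; eq_cases.
- rewrite !inE negb_or => /andP[xi xj].
  have [<-|ik] := eqVneq i k.
    by rewrite (set2C j i) !slide_id !mulg1.
  have [ji kj ki] : [/\ j != i, k != j & k != i].
    by split; rewrite eq_sym.
  by rewrite slideE // slideE_lr // !mulg1; eq_cases.
Qed.

(** A token that starts outside the first pair is outside the current pair at every stage, so
    [rule_track] applies wherever the fragment occurs. *)
Lemma step_track s t : step s t -> connected_seq s ->
  forall x, x \notin head set0 s ->
  track (head set0 s) (behead s) x = track (head set0 t) (behead t) x.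
Proof.
case=> p a b q ab sC x; have [[a0 b0] /andP[a2 _] _ hl] := rule_pres ab.
have := rule_track ab.
case: a b a0 b0 ab sC a2 hl => [//|e a] [//|f b] _ _ ab sC /andP[e2 _] hl.
have {hl}[/= ef lab] := hl set0; subst f => abE.
case: p sC => [|g p] /=.
  by move=> _ xe; rewrite !track_cat !permM abE // lab.
move=> /and3P[_ /= /andP[g2]]; rewrite all_cat /= => /andP[p2 _].
rewrite cat_path /= => /and3P[pC pe _] xg.
have trE c : track g (p ++ e :: c ++ q) x =
    track (last e c) q (track e c (slide (last g p) e (track g p x))).
  by rewrite track_cat /= track_cat !permM.
have l2 : two_subset (last g p).
  by have := mem_last g p; rewrite inE => /predU1P[->|/(allP p2)].
by rewrite !trE lab abE // mem_slide // mem_track.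
Qed.

Lemma seq_equiv_inv s t : s ~ t -> connected_seq s ->
  [/\ connected_seq t, head set0 s = head set0 t, last set0 s = last set0 t &
    forall x, x \notin head set0 s ->
    track (head set0 s) (behead s) x = track (head set0 t) (behead t) x].
Proof.
move=> /clos_rst_rst1n_iff; elim=> [//|{}s {}t u st _ IH] sC.
have [sCt hE lE tE] : [/\ connected_seq s = connected_seq t,
  head set0 s = head set0 t, last set0 s = last set0 t &
    forall x, x \notin head set0 s ->
    track (head set0 s) (behead s) x = track (head set0 t) (behead t) x].
  case: st sC => [st|ts] sC.
    by have [? ? ?] := connected_seq_step st; split=> // x; apply: step_track.
  have [tsC hE lE] := connected_seq_step ts; split=> // x xs.
  by rewrite -(step_track ts) ?tsC // hE.
have [uC hE' lE' tE'] := IH (etrans (esym sCt) sC).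
by split; rewrite ?hE ?lE // => x xt; rewrite -hE tE ?hE // tE'.
Qed.

(** * Bringing one position to rest *)

Definition edge A e f := [&& connected e f, two_subset f & f \subset A].

(** The bound [A] serves the induction that proves injectivity: positions brought to rest are
    removed from it one at a time. *)
Definition walk A e s := [&& two_subset e, e \subset A & path (edge A) e s].

Lemma walk_cons A e f s :
  walk A e (f :: s) = [&& two_subset e, e \subset A, connected e f & walk A f s].
Proof. by rewrite /walk /= /edge -!andbA. Qed.

Lemma walk_head A i j s : walk A [set i; j] s -> [/\ i != j, i \in A & j \in A].
Proof. by rewrite /walk two_subset2 subUset !sub1set => /and3P[-> /andP[-> ->]]. Qed.

Lemma walk_cons2 A i j k s : i != j -> i \in A ->
  walk A [set j; k] s -> walk A [set i; j] ([set j; k] :: s).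
Proof.
move=> ij iA jks; have [jk jA kA] := walk_head jks.
by rewrite walk_cons two_subset2 ij subUset !sub1set iA jA connected2.
Qed.

Section NormalForm.
Variables (A : {set 'I_n}) (p : 'I_n).

(* Position [p] is either never vacated, or filled once and for all by the
   token initially at [x], in the first two slides. *)
Inductive normal_form a b : seq {set 'I_n} -> Prop :=
| NormalStay s of walk (A :\ p) [set a; b] s :
    normal_form a b ([set a; b] :: s)
| NormalFill x s of x != b & walk (A :\ p) [set a; x] s :
    normal_form a b [:: [set a; b], [set a; p], [set a; x] & s].

Definition normalizes a b u := exists2 w, u ~ w & normal_form a b w.

Lemma equiv_normalizes a b u v : u ~ v -> normalizes a b v -> normalizes a b u.
Proof. by move=> uv [w vw nw]; exists w => //; apply: seq_equiv_trans uv vw. Qed.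

(** A fill that keeps [a] is rerouted to keep [b]: (III) inserts [{b, p}] before [{p, a}], then (II)
    turns [{p, a}] into [{b, x}]. *)
Lemma normalizes_swap a b u : a != b -> b \in A :\ p ->
  normalizes a b u -> normalizes b a u.
Proof.
move=> ab bA [w uw nw]; apply: (equiv_normalizes uw).
case: nw => [s abs|x s xb axs]; rewrite [[set a; b]]set2C.
  by exists ([set b; a] :: s); [apply: seq_equiv_refl | apply: NormalStay; rewrite set2C].
have [ax] := walk_head axs; rewrite !inE => /andP[ap aA] /andP[xp xA].
move: (bA); rewrite !inE => /andP[bp _].
exists [:: [set b; a], [set b; p], [set b; x], [set x; a] & s]; last first.
  apply: NormalFill; first by rewrite eq_sym.
  by apply: walk_cons2; rewrite ?[_ == x]eq_sym // set2C.
rewrite [[set b; a]]set2C.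
apply: (@seq_equiv_trans _ [:: [set a; b], [set b; p], [set p; a], [set a; x] & s]).
  apply: seq_equiv_sym; rewrite [[set a; p]]set2C.
  by apply: equivIII; rewrite // eq_sym.
apply: seq_equiv_cons; rewrite [[set x; a]]set2C; apply: equivII => //.
  by rewrite eq_sym.
by rewrite eq_sym.
Qed.

(** Once the normal form of [u] is swapped so as to keep [c], a fill is pulled to the front: (II)
    turns [{b, c}, {c, p}] into [{a, p}, {c, p}], and then [{c, p}] is replaced by [{a, x}] using
    (II), or dropped using (III) if [x = a]. *)
Lemma normalizes_cons a b c u : a != b -> b != c -> a \in A :\ p ->
  b \in A :\ p -> c \in A :\ p ->
  normalizes b c u -> normalizes a b ([set a; b] :: u).
Proof.
move=> ab bc aA bA cA bcu.
have [ca|ca] := eqVneq c a.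
  subst c; have [w uw nw] := normalizes_swap bc aA bcu.
  exists w => //; apply: (seq_equiv_trans (seq_equiv_cons _ uw)).
  by case: nw => [s _|x s _ _]; apply: equivI; rewrite two_subset2.
have [w uw nw] := normalizes_swap bc cA bcu.
apply: (equiv_normalizes (seq_equiv_cons _ uw)).
case: nw => [s cbs|x s xb cxs]; rewrite ![[set c; b]]set2C.
  exists [:: [set a; b], [set b; c] & s]; first exact: seq_equiv_refl.
  by apply/NormalStay/walk_cons2; rewrite // set2C.
have [cx _ xA] := walk_head cxs.
have [[ap bp] [cp xp]] : (a != p /\ b != p) /\ (c != p /\ x != p).
  by move: aA bA cA xA; rewrite !inE => /andP[-> _] /andP[-> _] /andP[-> _] /andP[-> _].
apply: (@equiv_normalizes _ _ _ [:: [set a; b], [set a; p], [set c; p], [set c; x] & s]).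
  by apply: equivII.
have [xa|xa] := eqVneq x a.
  subst x; exists [:: [set a; b], [set a; p], [set a; c] & s]; last first.
    by apply: NormalFill; rewrite 1?eq_sym // set2C.
  apply: seq_equiv_cons; rewrite [[set c; p]]set2C [[set a; c]]set2C.
  by apply: equivIII => //; rewrite eq_sym.
exists [:: [set a; b], [set a; p], [set a; x], [set x; c] & s]; last first.
  by apply: NormalFill => //; apply: walk_cons2; rewrite 1?eq_sym // set2C.
apply: seq_equiv_cons; rewrite [[set c; p]]set2C [[set x; c]]set2C.
by apply: equivII; rewrite // eq_sym.
Qed.

(** If [u] normalizes to a fill, its return to [{a, p}] is erased by (IV). A remaining detour
    [{a, b}, {a, p}, {a, b}] collapses by (IV) as well. *)
Lemma normalizes_fill a b y u : a != b -> a != y -> a \in A :\ p ->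
  normalizes a y u -> normalizes a b [:: [set a; b], [set a; p] & u].
Proof.
move=> ab ay aA [w uw nw].
have ap : a != p by move: aA; rewrite !inE => /andP[].
have ba : b != a by rewrite eq_sym.
apply: (equiv_normalizes (seq_equiv_cons _ (seq_equiv_cons _ uw))).
have del x s : [:: [set a; b], [set a; p], [set a; x] & s] ~
    (if x == b then [set a; b] :: s else [:: [set a; b], [set a; p], [set a; x] & s]).
  case: eqVneq => [->|_]; last exact: seq_equiv_refl.
  by rewrite [[set a; b]]set2C; apply: equivIV.
case: nw => [s ays|x s xy axs].
  apply: (equiv_normalizes (del _ _)); case: (eqVneq y b) => yb.
    by subst y; exists ([set a; b] :: s); [apply: seq_equiv_refl | apply: NormalStay].
  by eexists; [apply: seq_equiv_refl | apply: NormalFill].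
apply: (@equiv_normalizes _ _ _ [:: [set a; b], [set a; p], [set a; x] & s]).
  apply: seq_equiv_cons; rewrite [[set a; p]]set2C; apply: equivIV => //.
  by rewrite eq_sym.
apply: (equiv_normalizes (del _ _)); case: (eqVneq x b) => xb.
  by subst x; exists ([set a; b] :: s); [apply: seq_equiv_refl | apply: NormalStay].
by eexists; [apply: seq_equiv_refl | apply: NormalFill].
Qed.

(** Strong induction on the length. If the second pair avoids [p], [normalizes_cons] applies. If it
    contains [p] and the third does not, this is a fill. If both contain [p], then (I) or (III)
    shortens the sequence or (II) makes the second pair avoid [p]. *)
Lemma walk_normalizes a b s : walk A [set a; b] s ->
  p \notin [set a; b] -> p \notin last [set a; b] s ->
  normalizes a b ([set a; b] :: s).
Proof.
move: {2}(size s).+1 (ltnSn (size s)) => m.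
elim: m a b s => // m IH a b [|g s] /= sm.
  rewrite /walk => /and3P[ab abA _] pab _.
  exists [:: [set a; b]]; first exact: seq_equiv_refl.
  by apply: NormalStay; rewrite /walk ab subsetD1 abA pab.
move=> abgs pab pl; have [ab aA bA] := walk_head abgs.
(* By [normalizes_swap] the names [a] and [b] may be exchanged, so that [b] is kept by the first
   move. *)
wlog bg : a b ab aA bA abgs pab pl / b \in g.
  move=> IHb; have [bg|bg] := boolP (b \in g); first exact: IHb.
  move: pab; rewrite set2C => pba; have [ap bp] : a != p /\ b != p.
    by move: pba; rewrite !inE negb_or ![p == _]eq_sym => /andP[-> ->].
  have ag : a \in g.
    move: abgs; rewrite walk_cons => /and4P[_ _ /set0Pn[x]].
    by rewrite !inE => /andP[/orP[]/eqP->//]; rewrite (negPf bg).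
  apply: normalizes_swap; rewrite ?inE ?ap //; first by rewrite eq_sym.
  by apply: IHb; rewrite // 1?eq_sym // set2C.
have [ap bp] : a != p /\ b != p.
  by move: pab; rewrite !inE negb_or ![p == _]eq_sym => /andP[-> ->].
have [aAp bAp] : a \in A :\ p /\ b \in A :\ p by rewrite !inE ap bp.
have ba : b != a by rewrite eq_sym.
have gs : walk A g s by move: abgs; rewrite walk_cons => /and4P[].
have [c bc gE] : exists2 c, b != c & g = [set b; c].
  by apply: two_subsetP bg; case/and3P: gs.
subst g; have [cE|cp] := eqVneq c p; last first.
  have [_ _ cA] := walk_head gs.
  apply: normalizes_cons (IH _ _ _ sm gs _ pl) => //; first by rewrite !inE cp.
  by rewrite !inE negb_or ![p == _]eq_sym bp.
(* As the last term avoids [p], the pair [{b, p}] is followed by a third one. *)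
subst c; case: s sm pl abgs gs => [|g s] /= sm pl abgs gs.
  by rewrite !inE eqxx orbT in pl.
have [bpg g's] : connected [set b; p] g /\ walk A g s.
  by move: gs; rewrite walk_cons => /and4P[].
have g2 : two_subset g by case/and3P: g's.
have [pg|pg] := boolP (p \in g); last first.
  have bg' : b \in g.
    case/set0Pn: bpg => x; rewrite !inE => /andP[/orP[]/eqP->//].
    by rewrite (negPf pg).
  have [y byy gE] := two_subsetP g2 bg'; subst g.
  apply: normalizes_swap => //; rewrite [[set a; b]]set2C.
  apply: (normalizes_fill ba byy bAp).
  by apply: IH => //; apply: ltnW.
have [c pc gE] := two_subsetP g2 pg; subst g.
have [_ _ cA] := walk_head g's.
have [cb|cb] := eqVneq c b.
  subst c; apply: (@equiv_normalizes _ _ _ [:: [set a; b], [set b; p] & s]).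
    apply: seq_equiv_cons; rewrite [[set p; b]]set2C; apply: equivI.
    by rewrite two_subset2.
  rewrite [[set p; b]]set2C in g's pl.
  by apply: IH => //; apply: walk_cons2.
have [ca|ca] := eqVneq c a.
  subst c; apply: (@equiv_normalizes _ _ _ [:: [set a; b], [set p; a] & s]).
    exact: equivIII.
  apply: IH => //.
  by rewrite [[set a; b]]set2C [[set p; a]]set2C; apply: walk_cons2;
    rewrite // set2C.
(* Rule (II) postpones the first visit to [p]; the rest, starting at [{a, c}], is shorter. *)
apply: (@equiv_normalizes _ _ _ [:: [set a; b], [set a; c], [set p; c] & s]).
  by apply: equivII => //; rewrite eq_sym.
apply: normalizes_swap => //; rewrite [[set a; b]]set2C.
apply: (@normalizes_cons b a c) => //; first by rewrite eq_sym.
  by rewrite !inE cA eq_sym pc.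
apply: IH => //.
- rewrite [[set p; c]]set2C; apply: walk_cons2; first by rewrite eq_sym.
    by [].
  by rewrite set2C.
- by rewrite !inE negb_or ![p == _]eq_sym ap eq_sym pc.
Qed.
End NormalForm.

Lemma slide_fix e f x : x \notin e -> x \notin f -> slide e f x = x.
Proof.
move=> xe xf; rewrite /slide; case: pickP => [i|_]; last by rewrite perm1.
case: pickP => [k|_]; last by rewrite perm1.
rewrite !inE => /andP[_ kf] /andP[_ ie].
by rewrite tpermD //; [move: xe | move: xf]; apply: contraNneq => <-.
Qed.

Lemma walk_track_fix A p e s : walk (A :\ p) e s -> track e s p = p.
Proof.
elim: s e => [|f s IH] e; first by rewrite /= perm1.
rewrite walk_cons subsetD1 => /and4P[_ /andP[_ pe] _ fs] /=.
move: (fs); rewrite /walk subsetD1 => /and3P[_ /andP[_ pf] _].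
by rewrite permM slide_fix // IH.
Qed.

Lemma walk_connected A e s : walk A e s -> connected_seq (e :: s).
Proof.
rewrite /walk /connected_seq /= => /and3P[-> _]; rewrite /=.
by elim: s e => //= f s IH e /andP[/and3P[-> -> _] /IH].
Qed.

Lemma walk_last_track A e s x : walk A e s ->
  (track e s x \in last e s) = (x \in e).
Proof. by move=> /walk_connected /and3P[_ /andP[e2 s2] sC]; apply: mem_track. Qed.

(** The first slide exchanges [b] and [p] and misses [x], the second moves [x] to [p], and the rest
    never touches [p]. Thus the bijection determines [x]. *)
Lemma walk_fill_track A p a b x s : a != b -> p \notin [set a; b] -> x != b ->
  walk (A :\ p) [set a; x] s ->
  track [set a; b] [:: [set a; p], [set a; x] & s] x = p.
Proof.
rewrite !inE negb_or => ab /andP[pa pb] xb axs.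
have [ax _] := walk_head axs; rewrite !inE => /andP[xp _].
have [[ba ap bp] px] : [/\ b != a, a != p & b != p] /\ p != x.
  by do ![split]; rewrite eq_sym.
rewrite /= !permM slideE_l // slideE_l // (tpermD _ px) 1?eq_sym // tpermR.
exact: walk_track_fix axs.
Qed.

Lemma stay_equiv A e s : A \subset e -> walk A e s -> e :: s ~ [:: e].
Proof.
elim: s => [|f s IH] Ae; first by move=> _; apply: seq_equiv_refl.
rewrite walk_cons => /and4P[e2 _ _ fs].
have /and3P[f2 fA _] := fs.
have fe : f = e.
  by apply/eqP; rewrite eqEcard (subset_trans fA Ae) (eqP e2) (eqP f2).
by subst f; apply: seq_equiv_trans (equivI _ e2) (IH Ae fs).
Qed.

Lemma walk_rcons A e s f : walk A e (rcons s f) = walk A e s && edge A (last e s) f.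
Proof. by rewrite /walk rcons_path !andbA. Qed.

Lemma walk_last A e s : walk A e s -> two_subset (last e s) /\ last e s \subset A.
Proof.
elim: s e => [|f s IH] e; first by case/and3P.
by rewrite walk_cons => /and4P[_ _ _ /IH].
Qed.

Lemma equiv_back p c d e s : p != c -> c != d -> last e s = [set p; c] ->
  rcons (rcons (e :: s) [set c; d]) [set p; c] ~ e :: s.
Proof.
move=> pc cd; rewrite lastI => ->; rewrite -!cats1 -!catA /=.
have := seq_equiv_cat (belast e s) [::] (equivIV [::] pc cd).
by rewrite cats0.
Qed.

(** * Injectivity *)

(** Induction on the size of [A]. Both sequences are normalized at some [p] in [A] outside [e]. The
    token ending at [p] tells the two kinds of normal form apart and fixes [x], so only tails inside
    [A :\ p] remain to be compared. *)
Lemma equiv_of_track A e s t : walk A e s -> walk A e t ->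
  last e s = last e t ->
  (forall x, x \notin e -> track e s x = track e t x) -> e :: s ~ e :: t.
Proof.
move: {2}(#|A|).+1 (ltnSn #|A|) => m; elim: m A e s t => // m IH A e s t Am es et.
have [Ae _ _|] := boolP (A \subset e).
  exact: seq_equiv_trans (stay_equiv Ae es) (seq_equiv_sym (stay_equiv Ae et)).
case/subsetPn=> p pA pe.
have Ap : #|A :\ p| < m by move: Am; rewrite (cardsD1 p A) pA.
(* If p lies in the last pair {p, c}, append {c, d}; by (IV), returning to
   {p, c} undoes this. *)
wlog pl : s t es et / p \notin last e s.
  move=> IHl; have [pl|pl] := boolP (p \in last e s); last exact: IHl.
  move=> stl stx; have [l2 lA] := walk_last es.
  have [c pc lE] := two_subsetP l2 pl.
  (* Choosing [d] in [e] ensures that [d] lies in [A] and differs from [p]. *)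
  have [d de cd] : exists2 d, d \in e & c != d.
    have /and3P[/cards2P[a [b [ab ->]]] _ _] := es.
    have [->|ca] := eqVneq c a; last by exists a; rewrite // !inE eqxx.
    by exists b; rewrite // !inE eqxx orbT.
  have dA : d \in A by case/and3P: es => _ /subsetP/(_ _ de).
  have cA : c \in A by apply: (subsetP lA); rewrite lE !inE eqxx orbT.
  have pd : p != d by apply: contraNneq pe => ->.
  have cdE : edge A [set p; c] [set c; d].
    by rewrite /edge connected2 two_subset2 cd subUset !sub1set cA.
  have eqst : rcons (e :: s) [set c; d] ~ rcons (e :: t) [set c; d].
    apply: (IHl (rcons s _) (rcons t _)); rewrite ?walk_rcons ?last_rcons //.
    - by rewrite es lE.
    - by rewrite et -stl lE.
    - by rewrite !inE negb_or pc.
    - by move=> x xe; rewrite -!cats1 !track_cat !permM stx // stl.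
  apply: seq_equiv_trans (seq_equiv_sym (equiv_back pc cd lE)) _.
  apply: seq_equiv_trans (seq_equiv_rcons _ eqst) _.
  by apply: equiv_back; rewrite -?stl.
have /and3P[e2 eA _] := es; have /cards2P[a [b [ab eE]]] := e2.
move=> stl stx; have ptl : p \notin last e t by rewrite -stl.
have stC := walk_connected es; have ttC := walk_connected et.
subst e; have [u su nu] := walk_normalizes es pe pl.
have [v tv nv] := walk_normalizes et pe ptl.
apply: (seq_equiv_trans su); apply: seq_equiv_sym; apply: (seq_equiv_trans tv).
apply: seq_equiv_sym.
have [_ /= uh ul ut] := seq_equiv_inv su stC.
have [_ /= vh vl vt] := seq_equiv_inv tv ttC.
have uvl : last set0 u = last set0 v by rewrite -ul -vl.
have uvt x : x \notin [set a; b] ->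
    track [set a; b] (behead u) x = track [set a; b] (behead v) x.
  by move=> xe; rewrite {1}uh vh -ut // -vt // stx.
case: nu uvl uvt {su ut ul uh} => [u' nu|x u' xb nu] /=.
  case: nv {tv vt vl vh} => [v' nv|x v' xb nv] /= uvl uvt.
    exact: IH Ap nu nv uvl uvt.
  have [ax _ xA] := walk_head nv.
  (* In a mixed case the token of [x] and the token of [p] would both end at [p]. *)
  have xp : x = p; last by rewrite xp !inE eqxx in xA.
  have xab : x \notin [set a; b] by rewrite !inE negb_or eq_sym ax.
  apply: (@perm_inj _ (track [set a; b] u')); rewrite uvt //.
  by rewrite [LHS](walk_fill_track ab pe xb nv) (walk_track_fix nu).
have [ax _ xA] := walk_head nu.
have xab : x \notin [set a; b] by rewrite !inE negb_or eq_sym ax.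
have xpE := walk_fill_track ab pe xb nu.
case: nv {tv vt vl vh} => [v' nv|y v' yb nv] /= uvl uvt.
  have xp : x = p; last by rewrite xp !inE eqxx in xA.
  apply: (@perm_inj _ (track [set a; b] v')); rewrite -uvt //.
  by rewrite [LHS]xpE (walk_track_fix nv).
have xy : x = y.
  apply: (@perm_inj _ (track [set a; b] [:: [set a; p], [set a; y] & v'])).
  rewrite (walk_fill_track ab pe yb nv) -[RHS]xpE; exact/esym/uvt.
subst y; do 2!apply: seq_equiv_cons; apply: (IH _ _ _ _ Ap nu nv uvl) => y yax.
(* The two slides [r] are common to both sides; pulling [y] back through them gives a position
   outside [{a, b}], where the bijections agree. *)
set r := [:: [set a; p]; [set a; x]].
have [z yE] : exists z, y = track [set a; b] r z.
  by exists ((track [set a; b] r)^-1 y)%g; rewrite permKV.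
have apE : a != p by apply: contraNneq pe => <-; rewrite !inE eqxx.
have zab : z \notin [set a; b].
  rewrite -(@mem_track _ r); rewrite -?yE //= ?two_subset2 ?ab ?apE ?ax //.
  by rewrite set2C connected2 set2C connected2.
by have := uvt z zab; rewrite /= mulgA !permM yE /= !permM perm1.
Qed.

Lemma connected_walk e s : connected_seq (e :: s) -> walk setT e s.
Proof.
rewrite /walk /connected_seq subsetT => /= /andP[/andP[-> +]].
by elim: s e => //= f s IH e /andP[f2 s2] /andP[ef fs]; rewrite /edge ef f2 subsetT IH.
Qed.

Lemma imset_track A e s : walk A e s -> track e s @: e = last e s.
Proof.
move=> es; apply/setP=> y; rewrite -[y](permKV (track e s)).
by rewrite (walk_last_track _ es) mem_imset //; apply: perm_inj.
Qed.

(** * Surjectivity *)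

(** Quantifying over every initial pair makes the property closed under products: the second factor
    is realized from the pair where the first one ends. *)
Definition realizable (sigma : {perm 'I_n}) := forall e, two_subset e ->
  exists s, [/\ walk setT e s, last e s = sigma @: e
    & forall x, x \notin e -> track e s x = sigma x].

Lemma walk0 e : two_subset e -> walk setT e [::].
Proof. by rewrite /walk subsetT => ->. Qed.

Lemma realizable_mul sigma tau :
  realizable sigma -> realizable tau -> realizable (sigma * tau)%g.
Proof.
move=> rs rt e e2; have [s [es sE sx]] := rs e e2.
have [l2 _] := walk_last es; have [t [et tE tx]] := rt _ l2.
exists (s ++ t); split.
- move: es et; rewrite /walk cat_path !subsetT.
  by move=> /and3P[-> _ ->] /and3P[_ _ ->].
- by rewrite last_cat tE sE -imset_comp; apply: eq_imset => x; rewrite /= permM.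
- by move=> x xe; rewrite track_cat !permM -sx // tx // (walk_last_track _ es).
Qed.

Lemma realizable_tperm x y : x != y -> realizable (tperm x y).
Proof.
have real e s sigma : walk setT e s -> track e s = sigma ->
    exists s, [/\ walk setT e s, last e s = sigma @: e
      & forall x, x \notin e -> track e s x = sigma x].
  by move=> es <-; exists s; rewrite (imset_track es).
move=> xy e e2; wlog xye : x y xy / (y \in e) ==> (x \in e).
  case: (boolP ((y \in e) ==> (x \in e))) => [h H|]; first exact: H.
  rewrite negb_imply => /andP[ye xe] H; rewrite tpermC.
  by apply: H; rewrite 1?eq_sym // ye implybT.
have [xe|xe] := boolP (x \in e); last first.
  have ye : y \notin e by move: xye; rewrite (negPf xe) implybF.
  have /cards2P[i [j [ij eE]]] := e2; subst e.
  move: xe ye; rewrite !inE !negb_or => /andP[xi xj] /andP[yi yj].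
  have [[ji ix jx] [iy jy yx]] :
      [/\ j != i, i != x & j != x] /\ [/\ i != y, j != y & y != x].
    by do ![split]; rewrite eq_sym.
  (* While [j] stays empty, the other empty position travels from [i] to [x], to [y] and back to
     [i], which exchanges the tokens at [x] and [y]. *)
  apply: (real _ [:: [set j; x]; [set j; y]; [set j; i]]).
    rewrite !walk_cons walk0 !two_subset2 ?subsetT ?ij ?jx ?jy ?ji //= connected2.
    by rewrite [[set j; x]]set2C connected2 [[set j; y]]set2C connected2.
  by rewrite /= slideE // !slideE_l // !mulg1; apply/perm.permP => z; eq_cases.
have [j xj eE] := two_subsetP e2 xe; subst e.
have [yj|yj] := eqVneq y j.
  (* A transposition inside [e] preserves [e] and moves no token. *)
  subst j; exists [::]; rewrite walk0 //; split=> // [|z].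
    by rewrite imsetU1 imset_set1 tpermL tpermR set2C.
  by rewrite !inE negb_or => /andP[zx zy]; rewrite perm1 tpermD 1?eq_sym.
have jy : j != y by rewrite eq_sym.
apply: (real _ [:: [set j; y]]).
  by apply: walk_cons2; rewrite ?inE ?walk0 ?two_subset2.
by rewrite /= mulg1 slideE.
Qed.

Lemma realizableT sigma : realizable sigma.
Proof.
have [ts -> /allP dts] := prod_tpermP sigma.
elim: ts dts => [|[x y] ts IH] dts.
  move=> e e2; exists [::]; rewrite big_nil walk0 //; split=> //=.
  by rewrite (eq_imset _ (@perm1 _)) imset_id.
rewrite big_cons; apply: realizable_mul.
  by apply: realizable_tperm; apply: (dts (x, y)); rewrite inE eqxx.
by apply: IH => z zts; apply: dts; rewrite inE zts orbT.
Qed.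

Lemma perm_two_subset e f : two_subset e -> two_subset f ->
  exists sigma : {perm 'I_n}, sigma @: e = f.
Proof.
move=> /cards2P[a [b [ab ->]]] /cards2P[c [d [cd ->]]].
(* The first factor sends [a] to [c]; the second sends the image of [b] to [d] and fixes [c]. *)
exists (tperm a c * tperm (tperm a c b) d)%g.
have bc : tperm a c b != c by rewrite -{2}(tpermL a c) (inj_eq perm_inj) eq_sym.
by rewrite imsetU1 imset_set1 !permM !tpermL (tpermD bc) // eq_sym.
Qed.

(** * Counting *)

(* A fixed bijection from [e] to [f], so that bijections between their
   complements become permutations of the complement of [e]. *)
Definition transport e f : {perm 'I_n} :=
  odflt 1%g [pick sigma : {perm 'I_n} | sigma @: e == f].

Lemma transportE e f : two_subset e -> two_subset f -> transport e f @: e = f.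
Proof.
move=> e2 f2; rewrite /transport; case: pickP => [s /eqP //|].
by have [s /eqP sE] := perm_two_subset e2 f2 => /(_ s); rewrite sE.
Qed.

Definition fiber (c : {set 'I_n} * {set 'I_n} * {perm 'I_n}) :
    set (seq {set 'I_n}) :=
  [set s | [/\ connected_seq s, head set0 s = c.1.1, last set0 s = c.1.2 &
    forall x, x \notin c.1.1 ->
      track c.1.1 (behead s) x = transport c.1.1 c.1.2 (c.2 x)]]%classic.

(** [fiber] ignores [c.2] on the first pair; [perm_on] makes it the identity there, so that a class
    has only one code. *)
Definition code : pred ({set 'I_n} * {set 'I_n} * {perm 'I_n}) :=
  [pred c | [&& two_subset c.1.1, two_subset c.1.2 & perm_on (~: c.1.1) c.2]].

Lemma fiber_nonempty c : code c -> exists s, fiber c s.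
Proof.
case: c => [[e f] u] /and3P[/= e2 f2 ue].
have [s [es sl sx]] := realizableT (u * transport e f)%g e2.
exists (e :: s); split=> //=; first exact: walk_connected es.
  rewrite sl -[RHS](transportE e2 f2); apply: eq_in_imset => x xe.
  by rewrite permM (out_perm ue) // inE xe.
by move=> x xe; rewrite sx // permM.
Qed.

(** A common member determines both end pairs and, since [transport] is injective, the permutation
    off the first pair. *)
Lemma fiber_inj : {in code &, injective fiber}.
Proof.
move=> [[e f] u] [[e' f'] u'] cP cP' E.
have [s sc] := fiber_nonempty cP; move: (sc); rewrite E.
case: sc => /= _ ? ? sx [/= _ ? ? s'x]; subst e f e' f'.
case/and3P: cP cP' => /= _ _ ue /and3P[/= _ _ ue'].
congr (_, _); apply/perm.permP => x; case: (boolP (x \in head set0 s)) => xe.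
  by rewrite (out_perm ue) ?(out_perm ue') // inE xe.
by apply: (@perm_inj _ (transport (head set0 s) (last set0 s))); rewrite -sx // s'x.
Qed.

Lemma fiber_cover s : connected_seq s ->
  exists2 u, code (head set0 s, last set0 s, u) &
    fiber (head set0 s, last set0 s, u) s.
Proof.
case: s => // e s sC; have es := connected_walk sC.
have [l2 _] := walk_last es; have /and3P[e2 _ _] := es.
set r := transport e (last e s).
set v := (track e s * r^-1)%g.
have vN : v \in 'N(~: e | 'P)%g.
  apply/astabsP => x; rewrite !inE /= apermE permM; congr (~~ _).
  rewrite -(mem_imset _ _ (@perm_inj _ r)) permKV transportE //.
  by rewrite (walk_last_track _ es).
(* [v] preserves [e] but may exchange its two elements; the restriction to the complement discards
   this. *)
exists (restr_perm (~: e) v) => /=.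
  by apply/and3P; rewrite restr_perm_on.
by split=> //= x xe; rewrite (restr_permE vN) ?inE // /v permM permKV.
Qed.

(** One inclusion is the invariance of the bijection, [seq_equiv_inv]; the other is injectivity,
    [equiv_of_track] with all positions allowed. *)
Lemma fiber_class c s : fiber c s -> seq_class s = fiber c.
Proof.
case: c => [[e f] u] [/= sC sh sl sx]; apply/seteqP; split=> t.
  move=> [tC st]; have [_ he le tx] := seq_equiv_inv st sC.
  rewrite sh in he tx; rewrite sl in le.
  by split=> //= x xe; rewrite -sx // tx // -he.
case=> /= tC th tl tx; split=> //.
case: s t sC tC sh th sl tl sx tx => [//|e1 s] [//|e2 t] sC tC /= ? ? sl tl sx tx.
subst e1 e2; apply: (@equiv_of_track setT); rewrite ?sl ?tl //.
- exact: connected_walk.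
- exact: connected_walk.
- by move=> x xe; rewrite sx ?tx.
Qed.

Lemma classes_code : classes n = (fiber @` [set` code])%classic.
Proof.
apply/seteqP; split=> X [].
  move=> s sC <-; have [u uc us] := fiber_cover sC.
  by exists (head set0 s, last set0 s, u); rewrite // (fiber_class us).
move=> c cC <-; have [s sc] := fiber_nonempty cC.
by exists s; rewrite ?(fiber_class sc) //; case: sc.
Qed.

Lemma classes_between_code e f : two_subset e -> two_subset f ->
  classes_between e f =
  ((fun u => fiber (e, f, u)) @` [set` perm_on (~: e)])%classic.
Proof.
move=> e2 f2; apply/seteqP; split=> X [].
  move=> s [sC se sf] <-; have [u uc us] := fiber_cover sC.
  move: uc us; rewrite se sf => /and3P[_ _ uc] us.
  by exists u; rewrite // (fiber_class us).
move=> u ue <-; have cC : code (e, f, u) by apply/and3P.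
have [s sc] := fiber_nonempty cC.
by exists s; rewrite ?(fiber_class sc) //; case: sc.
Qed.

Lemma card_compl_two e : two_subset e -> #|~: e| = n - 2.
Proof. by move=> /eqP e2; rewrite cardsCs setCK e2 card_ord. Qed.

Lemma card_code : #|code| = 'C(n, 2) * 'C(n, 2) * (n - 2)`!.
Proof.
rewrite -sum1_card.
rewrite (eq_bigl (fun c => (two_subset c.1.1 && two_subset c.1.2) &&
  perm_on (~: c.1.1) c.2)) => [|c]; last by rewrite -andbA.
rewrite -(pair_big_dep (fun d : {set 'I_n} * {set 'I_n} =>
  two_subset d.1 && two_subset d.2) (fun d u => perm_on (~: d.1) u) (fun _ _ => 1)) /=.
rewrite (eq_bigr (fun=> (n - 2)`!)) => [|[e f] /= /andP[e2 _]]; last first.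
  by rewrite sum1_card card_perm card_compl_two.
rewrite -(pair_big (@two_subset n) (@two_subset n) (fun _ _ => (n - 2)`!)) /=.
rewrite sum_nat_const sum_nat_const mulnA.
have -> // : #|@two_subset n| = 'C(n, 2).
by rewrite -[in RHS](card_ord n) -card_draws cardsE.
Qed.
End Equivalence.

Lemma card_image_pred (T : finType) U (P : pred T) (F : T -> U) :
  {in P &, injective F} -> ((F @` [set` P])%classic #= `I_#|P|)%card.
Proof.
move=> Finj.
have -> : ([set` P] = @enum_val T P @` [set: 'I_#|P|])%classic.
  apply/seteqP; split=> x /=; last by case=> i _ <-; apply: enum_valP.
  by move=> xP; exists (enum_rank_in xP x); rewrite // enum_rankK_in.
rewrite image_comp.
apply: card_eq_trans (inj_card_eq _) _.
  move=> i j _ _ /= /Finj; move=> /(_ (enum_valP i) (enum_valP j)).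
  exact: enum_val_inj.
by rewrite card_eq_sym card_II.
Qed.

Theorem proposition17 (n : nat) (n_ge2 : 2 <= n) :
  (classes n #= `I_((n * (n - 1) * n`!) %/ 4))%card /\
  (forall e f : {set 'I_n}, two_subset e -> two_subset f ->
    (classes_between e f #= `I_((n - 2)`!))%card).
Proof.
split=> [|e f e2 f2].
  (* Both n (n - 1) = 2 'C(n, 2) and n! = 2 'C(n, 2) (n - 2)! contribute a factor 2, so the division
     by 4 is exact. *)
  have -> : (n * (n - 1) * n`!) %/ 4 = #|@code n|.
    rewrite card_code -(@bin_fact n 2) //.
    have -> : n * (n - 1) = 'C(n, 2) * 2`!.
      by rewrite bin_ffact ffactnS ffactn1 subn1.
    by rewrite mulnACA (mulnA 2`!) (mulnC (2`! * _)) mulnA mulnK.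
  by rewrite classes_code; apply/card_image_pred/fiber_inj.
rewrite classes_between_code // -(card_compl_two e2) -card_perm.
apply: card_image_pred => u v ue ve /= uv.
have codeP w : perm_on (~: e) w -> code (e, f, w) by move=> we; apply/and3P.
by have [] := fiber_inj (codeP u ue) (codeP v ve) uv.
Qed.
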